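(* Let $\Gamma\in\mathbb{K}^{d_1\times\cdots\times d_\ell}$ be an $\ell$-tensor with modes $U_1,\ldots,U_\ell$, let $\mathcal{C}$ be an $\ell$-chisel (an $m\times\ell$ matrix over $\mathbb{K}$), and let $(D_1,\ldots,D_\ell)$ be a diagonalizable $\mathcal{C}$-derivation of $\Gamma$, i.e. a $\mathcal{C}$-derivation in which every $D_a:U_a\to U_a$ is diagonalizable over $\mathbb{K}$. For each $a\in\{1,\ldots,\ell\}$, let $X_{a1},\ldots,X_{ak_a}$ be the eigenspaces of $D_a$, with eigenvalues $\delta_{a1},\ldots,\delta_{ak_a}$ respectively, and put $\delta_a=(\delta_{a1},\ldots,\delta_{ak_a})\in\mathbb{K}^{k_a}$. Then the eigenspace decompositions $U_a=X_{a1}\oplus\cdots\oplus X_{ak_a}$ ($1\leq a\leq\ell$) of the modes exhibit the sparsity pattern $\Delta(\mathcal{C},(\delta_1,\ldots,\delta_\ell))$ of $\Gamma$.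
   Context: $\mathbb{K}$ is a field and $[k]=\{1,\ldots,k\}$. An $\ell$-tensor is an array $\Gamma\in\mathbb{K}^{d_1\times\cdots\times d_\ell}$, with modes $U_a=\mathbb{K}^{d_a}$ for $a\in[\ell]$, interpreted as the multilinear form $U_1\times\cdots\times U_\ell\to\mathbb{K}$ given by $$\langle\Gamma\mid u_1,\ldots,u_\ell\rangle=\sum_{i_1\in[d_1]}\cdots\sum_{i_\ell\in[d_\ell]}\Gamma_{i_1\cdots i_\ell}\,u_{1i_1}\cdots u_{\ell i_\ell}.$$ For subspaces $Y_a\leq U_a$, $\langle\Gamma\mid Y_1,\ldots,Y_\ell\rangle$ denotes the span of all values $\langle\Gamma\mid y_1,\ldots,y_\ell\rangle$ with $y_a\in Y_a$. Decompositions $U_a=X_{a1}\oplus\cdots\oplus X_{ak_a}$ ($a\in[\ell]$) exhibit a set $\Delta\subseteq\prod_{a}[k_a]$ as a sparsity pattern for $\Gamma$ if $$(i_1,\ldots,i_\ell)\notin\Delta\ \Longrightarrow\ \langle\Gamma\mid X_{1i_1},\ldots,X_{\ell i_\ell}\rangle=0.$$ An $\ell$-chisel is an $m\times\ell$ matrix $\mathcal{C}$ with entries $\mathcal{C}_{ja}\in\mathbb{K}$. For $\delta=(\delta_1,\ldots,\delta_\ell)\in\mathbb{K}^{k_1}\times\cdots\times\mathbb{K}^{k_\ell}$, writing $\delta_{ai}$ for the $i$-th entry of $\delta_a$, $$\Delta(\mathcal{C},\delta)=\Big\{(i_1,\ldots,i_\ell)\in\prod_{a=1}^{\ell}[k_a]\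 :\ \forall j\in[m],\ \sum_{a=1}^{\ell}\mathcal{C}_{ja}\,\delta_{ai_a}=0\Big\}.$$ A tuple $(D_1,\ldots,D_\ell)$ of linear operators $D_a:U_a\to U_a$ is a $\mathcal{C}$-derivation of $\Gamma$ if for every $j\in[m]$ and all $(u_1,\ldots,u_\ell)\in U_1\times\cdots\times U_\ell$, $$\sum_{a=1}^{\ell}\mathcal{C}_{ja}\,\langle\Gamma\mid u_1,\ldots,u_{a-1},D_au_a,u_{a+1},\ldots,u_\ell\rangle=0.$$ *)

(* Defs.v *)
From mathcomp Require Import all_boot all_order all_algebra.

Set Implicit Arguments.
Unset Strict Implicit.
Unset Printing Implicit Defensive.

Import GRing.Theory.
Local Open Scope ring_scope.

Notation multi_index d := {dffun forall a, 'I_(d a)}.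

Definition tensor (K : fieldType) (l : nat) (d : 'I_l -> nat) : Type :=
  {ffun multi_index d -> K}.

Definition tensor_form (K : fieldType) (l : nat) (d : 'I_l -> nat)
    (G : tensor K d) (u : forall a : 'I_l, 'rV[K]_(d a)) : K :=
  \sum_(i : multi_index d) G i * \prod_(a < l) u a 0 (i a).

(* The span in K of the values of the form on the subspaces [Y a], as the
   predicate "is a finite linear combination of such values". *)
Definition tensor_span (K : fieldType) (l : nat) (d : 'I_l -> nat)
    (G : tensor K d) (Y : forall a : 'I_l, {vspace 'rV[K]_(d a)}) (s : K) : Prop :=
  exists (n : nat) (c : 'I_n -> K) (y : 'I_n -> forall a : 'I_l, 'rV[K]_(d a)),
    (forall t a, y t a \in Y a) /\
    s = \sum_(t < n) c t * tensor_form G (y t).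

Definition is_decomposition (K : fieldType) (V : vectType K) (k : nat)
    (X : 'I_k -> {vspace V}) : Prop :=
  (\sum_(i < k) X i)%VS = fullv /\ directv (\sum_(i < k) X i).

Definition exhibits_sparsity (K : fieldType) (l : nat) (d : 'I_l -> nat)
    (G : tensor K d) (k : 'I_l -> nat)
    (X : forall a : 'I_l, 'I_(k a) -> {vspace 'rV[K]_(d a)})
    (Delta : {set multi_index k}) : Prop :=
  (forall a, is_decomposition (X a)) /\
  (forall i : multi_index k, i \notin Delta ->
     forall s : K, tensor_span G (fun a => X a (i a)) s <-> s = 0).

Definition chisel_pattern (K : fieldType) (m l : nat) (C : 'M[K]_(m, l))
    (k : 'I_l -> nat) (delta : forall a : 'I_l, 'rV[K]_(k a)) :
    {set multi_index k} :=
  [set i : multi_index k |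
    [forall j : 'I_m, \sum_(a < l) C j a * delta a 0 (i a) == 0]].

(* [dfwith u x], for [x] of type ['rV_(d a)], is [u] with its [a]-th
   component replaced by [x]. *)
Definition is_derivation (K : fieldType) (m l : nat) (C : 'M[K]_(m, l))
    (d : 'I_l -> nat) (G : tensor K d)
    (D : forall a : 'I_l, 'End('rV[K]_(d a))) : Prop :=
  forall (j : 'I_m) (u : forall a : 'I_l, 'rV[K]_(d a)),
    \sum_(a < l) C j a * tensor_form G (dfwith u (D a (u a))) = 0.

(* [lin1_mx D] is the matrix of [D] in the standard basis, acting on the
   right of row vectors; [diagonalizable] is similarity over K to a diagonal
   matrix. *)
Definition diagonalizable_end (K : fieldType) (n : nat)
    (D : 'End('rV[K]_n)) : Prop :=
  diagonalizable (lin1_mx D).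

(* [X] lists, without repetition, all the eigenspaces of [D], and [delta] the
   corresponding eigenvalues. *)
Definition eigenspace_listing (K : fieldType) (n : nat) (D : 'End('rV[K]_n))
    (k : nat) (X : 'I_k -> {vspace 'rV[K]_n}) (delta : 'rV[K]_k) : Prop :=
  [/\ injective (fun i : 'I_k => delta 0 i),
      forall c : K, passmx.leigenvalue D c <-> exists i : 'I_k, delta 0 i = c
    & forall i : 'I_k, X i = passmx.leigenspace D (delta 0 i)].

(* Main.v *)
Require Import Defs.
From mathcomp Require Import all_boot all_order all_algebra.

Set Implicit Arguments.
Unset Strict Implicit.
Unset Printing Implicit Defensive.

Import GRing.Theory.
Local Open Scope ring_scope.

(** The statement has two halves.

    The eigenspaces of a diagonalizable operator decompose its space: they are
    independent because the eigenvalues are distinct, and they span because a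
    basis of eigenvectors exists ([eigenspaces_decompose]).

    For the vanishing, let [u] consist of eigenvectors, [u a] belonging to the
    eigenvalue [c a] of [D a]. Replacing [D a (u a)] by [c a *: u a] and pulling
    the scalar out of the multilinear form turns the [j]-th derivation identity
    into [(\sum_a C j a * c a) * tensor_form G u = 0]
    ([tensor_form_derivation_eigen]). Outside the pattern some row [j] of the
    chisel makes the first factor nonzero, so the form vanishes on such [u],
    hence so does the span of its values. *)

Lemma tensor_formZ (K : fieldType) (l : nat) (d : 'I_l -> nat)
    (G : tensor K d) (u : forall a, 'rV[K]_(d a)) (a : 'I_l) (c : K) :
  tensor_form G (dfwith u (c *: u a)) = c * tensor_form G u.
Proof.
rewrite /tensor_form mulr_sumr; apply: eq_bigr => i _.
rewrite mulrCA; congr (_ * _).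
rewrite (bigD1 a) //= dfwith_in mxE [in RHS](bigD1 a) //= mulrA.
congr (_ * _); apply: eq_bigr => b ba.
by rewrite dfwith_out // eq_sym.
Qed.

Lemma tensor_form_derivation_eigen (K : fieldType) (m l : nat)
    (C : 'M[K]_(m, l)) (d : 'I_l -> nat) (G : tensor K d)
    (D : forall a : 'I_l, 'End('rV[K]_(d a)))
    (u : forall a : 'I_l, 'rV[K]_(d a)) (c : 'I_l -> K) (j : 'I_m) :
  is_derivation C G D -> (forall a, D a (u a) = c a *: u a) ->
  (\sum_(a < l) C j a * c a) * tensor_form G u = 0.
Proof.
move=> /(_ j u) HD Du; rewrite mulr_suml -[RHS]HD.
by apply: eq_bigr => a _; rewrite Du tensor_formZ mulrA.
Qed.

Lemma mem_leigenspace (K : fieldType) (n : nat) (D : 'End('rV[K]_n)) (c : K) v :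
  (v \in passmx.leigenspace D c) = (D v == c *: v).
Proof.
by rewrite /passmx.leigenspace memv_ker !lfun_simp subr_eq0.
Qed.

(** Transfers membership to the row spaces of matrices, where the theory of
    diagonalization is developed. *)
Lemma mem_leigenspace_mx (K : fieldType) (n : nat) (D : 'End('rV[K]_n))
    (c : K) v :
  (v \in passmx.leigenspace D c) = (v <= eigenspace (lin1_mx D) c)%MS.
Proof.
by rewrite mem_leigenspace; apply/eqP/eigenspaceP; rewrite mul_rV_lin1.
Qed.

(** Distinctness of the listed eigenvalues gives independence; completeness of
    the list is what makes the listed eigenspaces span, since the scalars [rs]
    supplied by diagonalizability are otherwise unrelated to the list. *)
Lemma eigenspaces_decompose (K : fieldType) (n : nat) (D : 'End('rV[K]_n))
    (k : nat) (X : 'I_k -> {vspace 'rV[K]_n}) (delta : 'rV[K]_k) :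
  diagonalizable_end D -> eigenspace_listing D X delta -> is_decomposition X.
Proof.
move=> /diagonalizablePeigen[rs _ rs1] [inj_delta eigE XE]; split.
  apply/eqP; rewrite eqEsubv subvf /=.
  apply/subvP => v _.
  have: (v <= \sum_(r <- rs) eigenspace (lin1_mx D) r)%MS by rewrite rs1 submx1.
  rewrite (big_nth 0) big_mkord => /sub_sumsmxP[w ->].
  apply: memv_suml => t _.
  set x := (_ *m _).
  have: x \in passmx.leigenspace D rs`_t by rewrite mem_leigenspace_mx /x submxMl.
  have [->|x_neq0 xr] := eqVneq x 0; first by rewrite !mem0v.
  (* A nonzero component certifies that its scalar is an eigenvalue, hence
     listed; the other scalars contribute nothing. *)
  have /eigE[i ri] : passmx.leigenvalue D rs`_t.
    by apply: contraNneq x_neq0 => r0; rewrite r0 memv0 in xr.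
  by move: xr; rewrite -ri -XE; apply/subvP/(sumv_sup i).
have /mxdirect_sumsP dir :
    mxdirect (\sum_(i < k) eigenspace (lin1_mx D) (delta 0 i)).
  by apply: mxdirect_sum_eigenspace => i j _ _; apply: inj_delta.
apply/directv_sumP => i _; apply/eqP; rewrite -subv0.
apply/subvP => v; rewrite memv_cap memv0 => /andP[vi /memv_sumP[w wX vE]].
rewrite -submx0 -(dir i) // sub_capmx -mem_leigenspace_mx -XE vi /= vE.
apply: summx_sub_sums => j ji.
by rewrite -mem_leigenspace_mx -XE wX.
Qed.

Theorem theorem5p5 (K : fieldType) (l m : nat) (d : 'I_l -> nat)
    (G : tensor K d) (C : 'M[K]_(m, l))
    (D : forall a : 'I_l, 'End('rV[K]_(d a)))
    (HD : is_derivation C G D)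
    (Hdiag : forall a : 'I_l, diagonalizable_end (D a))
    (k : 'I_l -> nat)
    (X : forall a : 'I_l, 'I_(k a) -> {vspace 'rV[K]_(d a)})
    (delta : forall a : 'I_l, 'rV[K]_(k a))
    (HX : forall a : 'I_l, eigenspace_listing (D a) (X a) (delta a)) :
  exhibits_sparsity G X (chisel_pattern C delta).
Proof.
split=> [a|i]; first exact: eigenspaces_decompose (Hdiag a) (HX a).
rewrite inE negb_forall => /existsP[j Cj_neq0] s; split=> [|->]; last first.
  by exists 0%N, (fun=> 0), (fun _ _ => 0); split=> [[]|] //; rewrite big_ord0.
case=> n [c [y [yX ->]]]; apply: big1 => t _.
have Dy a : D a (y t a) = delta a 0 (i a) *: y t a.
  by have [_ _ XE] := HX a; apply/eqP; rewrite -mem_leigenspace -XE yX.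
have /eqP := tensor_form_derivation_eigen j HD Dy.
by rewrite mulf_eq0 (negPf Cj_neq0) /= => /eqP ->; rewrite mulr0.
Qed.
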